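(* Let $(X,\tau)$ and $(Y,\zeta)$ be topological spaces with rough families $\mathcal{F}$ on $X$ and $\mathcal{L}$ on $Y$. If $(X,\tau)$ and $(Y,\zeta)$ are $(\mathcal{F},\mathcal{L})$-homeomorphic, then the topological spaces $(X,\tau^{\mathcal{F}})$ and $(Y,\zeta^{\mathcal{L}})$ are homeomorphic.
   Context: A rough family on a set $X$ is an indexed family $\mathcal{F}=\{F_x : x\in X\}$ of subsets of $X$ with $x\in F_x$ for all $x\in X$. For a topological space $(X,\tau)$ with rough family $\mathcal{F}$ and $A\subset X$, the rough interior is $A^{o\mathcal{F}}=\{x\in A:\text{ there is a }\tau\text{-open set }U\text{ with }F_x\subset U\subset A\}$; $A$ is $\mathcal{F}$-open if $A^{o\mathcal{F}}=A$. The rough topology is $\tau^{\mathcal{F}}=\{A\subset X: A^{o\mathcal{F}}=A\}$, which is a topology on $X$ (similarly $\zeta^{\mathcal{L}}$ on $Y$). A map $f:X\to Y$ is $(\mathcal{F},\mathcal{L})$-continuous if $f^{-1}(V)$ is $\mathcal{F}$-open in $(X,\tau)$ for every $\mathcal{L}$-open set $V$ in $(Y,\zeta)$. A map $f:X\to Y$ is an $(\mathcal{F},\mathcal{L})$-homeomorphism if it is bijective, $(\mathcal{F},\mathcal{L})$-continuous, and $f^{-1}:Y\to X$ is $(\mathcal{L},\mathcal{F})$-continuous; the spaces are $(\mathcal{F},\mathcal{L})$-homeomorphic if such an $f$ exists. *)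

(* Defs.v *)
From HB Require Import structures.
From mathcomp Require Import all_boot.
From mathcomp Require Import boolp classical_sets functions topology.

Set Implicit Arguments.
Unset Strict Implicit.
Unset Printing Implicit Defensive.

Local Open Scope classical_set_scope.

Record roughFamily (X : Type) := RoughFamily {
  rough_set :> X -> set X;
  rough_set_self : forall x, rough_set x x
}.

Section Rough.
Context {X : topologicalType}.
Implicit Types (F : roughFamily X) (A B : set X).

Definition rough_interior F A : set X :=
  [set x | A x /\ exists U : set X, [/\ open U, F x `<=` U & U `<=` A]].

Definition rough_open F A : Prop := rough_interior F A = A.

Definition rough_topology F : set (set X) := [set A | rough_open F A].

Lemma rough_openP F A :
  rough_open F A <->
  forall x, A x -> exists U : set X, [/\ open U, F x `<=` U & U `<=` A].
Proof.
split=> [oA x|h]; first by rewrite -{1}oA => -[].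
by apply/seteqP; split=> x; [case | move=> Ax; split=> //; exact: h].
Qed.

Lemma rough_topologyT F : rough_topology F [set: X].
Proof. by apply/rough_openP => x _; exists setT; split=> //; exact: openT. Qed.

Lemma rough_topologyI F : setI_closed (rough_topology F).
Proof.
move=> A B /rough_openP oA /rough_openP oB; apply/rough_openP => x [Ax Bx].
have [U [oU FU UA]] := oA x Ax; have [V [oV FV VB]] := oB x Bx.
exists (U `&` V); split; first exact: openI.
- by move=> y Fy; split; [exact: FU | exact: FV].
- by move=> y [/UA ? /VB].
Qed.

Lemma rough_topology_bigU F (I : Type) (f : I -> set X) :
  (forall i, rough_topology F (f i)) -> rough_topology F (\bigcup_i f i).
Proof.
move=> of_; apply/rough_openP => x [i _ fix_].
have /rough_openP/(_ x fix_) [U [oU FU Uf]] := of_ i.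
by exists U; split=> // y /Uf; exists i.
Qed.

End Rough.

(* An alias of X, so that the type can carry the rough topology while X keeps
   its own. *)
Definition rough_space (X : topologicalType) (F : roughFamily X) : Type := X.

HB.instance Definition _ (X : topologicalType) (F : roughFamily X) :=
  Choice.copy (rough_space F) X.
HB.instance Definition _ (X : topologicalType) (F : roughFamily X) :=
  isOpenTopological.Build (rough_space F)
    (rough_topologyT F) (@rough_topologyI X F) (@rough_topology_bigU X F).

Lemma rough_space_openE (X : topologicalType) (F : roughFamily X) :
  (open : set (set (rough_space F))) = rough_topology F.
Proof. by []. Qed.

Definition rough_continuous (X Y : topologicalType) (F : roughFamily X)
    (L : roughFamily Y) (f : X -> Y) : Prop :=
  forall V : set Y, rough_open L V -> rough_open F (f @^-1` V).

(* Bijectivity is given by the two-sided inverse g, necessarily unique, on which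
   continuity of the inverse is then required; likewise in [homeomorphism]. *)
Definition rough_homeomorphism (X Y : topologicalType) (F : roughFamily X)
    (L : roughFamily Y) (f : X -> Y) : Prop :=
  exists g : Y -> X, [/\ cancel f g, cancel g f,
    rough_continuous F L f & rough_continuous L F g].

Definition rough_homeomorphic (X Y : topologicalType) (F : roughFamily X)
    (L : roughFamily Y) : Prop :=
  exists f : X -> Y, rough_homeomorphism F L f.

Definition homeomorphism (X Y : topologicalType) (f : X -> Y) : Prop :=
  exists g : Y -> X, [/\ cancel f g, cancel g f, continuous f & continuous g].

Definition homeomorphic (X Y : topologicalType) : Prop :=
  exists f : X -> Y, homeomorphism f.

(* Main.v *)
Require Import Defs.
From mathcomp Require Import all_boot.
From mathcomp Require Import boolp classical_sets functions topology.

(** The open sets of [rough_space F] are by construction the rough open sets,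
    so rough continuity is the preimage characterization of ordinary continuity
    between the rough spaces ([rough_continuousP]). A rough homeomorphism and
    its inverse are therefore, unchanged, a homeomorphism of these spaces. *)

Lemma rough_continuousP (X Y : topologicalType)
    (F : roughFamily X) (L : roughFamily Y) (f : X -> Y) :
  rough_continuous F L f <->
  continuous (f : rough_space F -> rough_space L).
Proof. by split=> [cf|/continuousP cf]; first exact/continuousP. Qed.

Theorem theorem4p8 (X Y : topologicalType)
    (F : roughFamily X) (L : roughFamily Y) :
  rough_homeomorphic F L ->
  homeomorphic (rough_space F) (rough_space L).
Proof.
move=> [f [g [fK gK /rough_continuousP cf /rough_continuousP cg]]].
by exists f, g.
Qed.
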